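(* Let $r,k\ge2$ be integers and $c>0$. Let $(\mathcal H_n)_{n\in\mathbb N}$ be a sequence of $k$-uniform hypergraphs and let $(p_n)_{n\in\mathbb N}$ with $p_n\in(0,1)$ satisfy $p_n\to0$ and $p_n v(\mathcal H_n)\to\infty$ as $n\to\infty$, and such that for each sufficiently large $n$ and each $\ell\in[k]$, $\Delta_\ell(\mathcal H_n)\le c\,p_n^{\ell-1}\frac{e(\mathcal H_n)}{v(\mathcal H_n)}$. Suppose further that $(\mathcal H_n)_{n\in\mathbb N}$ is $r$-supersaturated. Then there exists $C\ge1$ such that for $q_n\ge Cp_n$ (with $q_n\le1$), $\lim_{n\to\infty}\mathbb P[\mathcal H^v_{n,q_n}\text{ is }r\text{-Ramsey}]=1$.
   Context: A $k$-uniform hypergraph $\mathcal H$ has a finite vertex set $V(\mathcal H)$ and a set $E(\mathcal H)$ of $k$-element subsets of $V(\mathcal H)$; $v(\mathcal H)=|V(\mathcal H)|$, $e(\mathcal H)=|E(\mathcal H)|$. $\Delta_i(\mathcal H):=\max_{f\subseteq V(\mathcal H),|f|=i}|\{e\in E(\mathcal H):f\subseteq e\}|$. $\mathcal H^v_p$ is obtained by keeping each vertex independently with probability $p$ and keeping exactly the edges all of whose vertices are kept. $\mathcal H$ is $r$-Ramsey if every $r$-colouring of $V(\mathcal H)$ yields a monochromatic edge; it is $(r,\varepsilon)$-supersaturated if every $r$-colouring of $V(\mathcal H)$ yields at least $\varepsilon e(\mathcal H)$ monochromatic edges; a sequence is $r$-supersaturated if there are $\varepsilon>0$ and $n_0$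 such that $\mathcal H_n$ is $(r,\varepsilon)$-supersaturated for all $n\ge n_0$.
   Formalization: The hypergraphs H_n are additionally assumed to have at least one edge for all sufficiently large n; without this, edgeless hypergraphs satisfy all hypotheses (the bounds read 0 ≤ 0) but are never r-Ramsey. *)

(* Defs.v *)
From HB Require Import structures.
From mathcomp Require Import all_boot all_order all_algebra.
From mathcomp Require Import all_classical all_reals all_analysis.

Set Implicit Arguments.
Unset Strict Implicit.
Unset Printing Implicit Defensive.

Import Order.TTheory GRing.Theory Num.Theory.
Import numFieldNormedType.Exports.

Local Open Scope ring_scope.

Record hypergraph (k : nat) := Hypergraph {
  vert : finType;
  edges : {set {set vert}};
  edges_uniform : forall e, e \in edges -> #|e| = k
}.

Definition nvert (k : nat) (H : hypergraph k) : nat := #|vert H|.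
Definition nedge (k : nat) (H : hypergraph k) : nat := #|edges H|.

Definition maxdeg (k : nat) (H : hypergraph k) (i : nat) : nat :=
  (\max_(f : {set vert H} | #|f| == i) #|[set e in edges H | f \subset e]|)%N.

(* An edge contained in W is represented by its preimage in the subtype of W. *)
Definition induced_edges (k : nat) (H : hypergraph k) (W : {set vert H}) :
    {set {set {x : vert H | x \in W}}} :=
  [set e : {set {x : vert H | x \in W}} | [set val x | x in e] \in edges H].

Lemma induced_uniform (k : nat) (H : hypergraph k) (W : {set vert H}) e :
  e \in induced_edges W -> #|e| = k.
Proof. by rewrite inE => /edges_uniform; rewrite (card_imset _ val_inj). Qed.

Definition induced (k : nat) (H : hypergraph k) (W : {set vert H}) :
  hypergraph k := Hypergraph (@induced_uniform k H W).

Definition mono_edges (k r : nat) (H : hypergraph k)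
    (chi : {ffun vert H -> 'I_r}) : {set {set vert H}} :=
  [set e in edges H | [exists i : 'I_r, [forall x in e, chi x == i]]].

Definition ramsey (k r : nat) (H : hypergraph k) : bool :=
  [forall chi : {ffun vert H -> 'I_r}, mono_edges chi != finset.set0].

Definition supersaturated (R : realType) (k r : nat) (eps : R)
    (H : hypergraph k) : Prop :=
  forall chi : {ffun vert H -> 'I_r},
    eps * (nedge H)%:R <= #|mono_edges chi|%:R.

Definition supersaturated_seq (R : realType) (k r : nat)
    (H : nat -> hypergraph k) : Prop :=
  exists eps : R, 0 < eps /\
    exists n0 : nat, forall n : nat, (n0 <= n)%N -> supersaturated r eps (H n).

(* Probability that W is exactly the set of kept vertices, when each vertex is
   kept independently with probability q. *)
Definition keep_prob (R : realType) (T : finType) (q : R) (W : {set T}) : R :=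
  \prod_(x : T) (if x \in W then q else 1 - q).

(* Probability that the random induced subhypergraph of H at density q has the
   property P. *)
Definition prob_vrandom (R : realType) (k : nat) (H : hypergraph k) (q : R)
    (P : hypergraph k -> bool) : R :=
  \sum_(W : {set vert H} | P (induced W)) keep_prob q W.

(* Main.v *)
(* The proof goes through hypergraph containers. Vertices are scanned in a fixed
   order; a vertex of the independent set I whose link (away from saturated sets)
   is heavy joins the fingerprint, and its link is added to an auxiliary
   hypergraph W of uniformity one less, in which I is again independent. If W
   becomes dense, recurse on W; otherwise few edges meet saturated sets, so
   linearly many vertices are heavy, and those outside the small fingerprint
   miss I. The set found depends on I only through a certificate S, in the sense
   that every B with S <= B <= I yields the same set. Iterating gives a container
   of I spanning few edges and determined by a certificate of size O(pN).
   If the random set W is not Ramsey, its colour classes lie in r containers, and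
   supersaturation forces the containers to miss at least delta N vertices, all
   of which are absent from W, while the certificates are contained in W. For
   q >= Cp a union bound over certificates gives failure probability at most
   exp(-Omega(pN)). *)

Require Import Defs.
From HB Require Import structures.
From mathcomp Require Import all_boot all_order all_algebra.
From mathcomp Require Import unstable reals sequences exp ring lra.

Set Implicit Arguments.
Unset Strict Implicit.
Unset Printing Implicit Defensive.

Import Order.TTheory GRing.Theory Num.Theory.

Local Open Scope ring_scope.

(** * Weighted hypergraphs and their codegrees *)

Section Weights.
Variables (R : realFieldType) (V : finType).
Implicit Types (w W : {set V} -> R) (S T f : {set V}).

(** A weight function on all vertex subsets stands for a hypergraph with multiplicities, since links
    of different vertices may overlap when added up. *)
Definition codeg w T : R := \sum_(f : {set V} | T \subset f) w f.
Definition total w : R := \sum_f w f.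

Lemma codeg_set0 w : codeg w set0 = total w.
Proof. by apply: eq_bigl => f; rewrite sub0set. Qed.

Lemma total_ge0 w : (forall f, 0 <= w f) -> 0 <= total w.
Proof. by move=> w0; apply: sumr_ge0. Qed.

Lemma codeg_ge0 w T : (forall f, 0 <= w f) -> 0 <= codeg w T.
Proof. by move=> w0; apply: sumr_ge0. Qed.

Lemma sum_codeg w s : (forall f, 0 <= w f) ->
  (forall f, w f != 0 -> (#|f| <= s)%N) ->
  \sum_T codeg w T <= 2 ^+ s * total w.
Proof.
move=> w0 ws; rewrite /codeg (exchange_big_dep xpredT) //= /total mulr_sumr.
apply: ler_sum => f _; rewrite sumr_const -[leLHS]mulr_natl.
have [->|wf] := eqVneq (w f) 0; first by rewrite !mulr0.
apply: ler_wpM2r => //.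
have -> : #|[pred T : {set V} | T \subset f]| = (2 ^ #|f|)%N.
  by rewrite -card_powerset; apply: eq_card => T; rewrite !inE.
by rewrite natrX ler_weXn2l ?ws // ler1n.
Qed.

End Weights.

(** * The scanning process *)

Section Process.
Variables (R : realFieldType) (V : finType).
Variables (w : {set V} -> R) (D : {set V} -> R) (z : R).
Implicit Types (W : {set V} -> R) (A B S T f : {set V}) (s : seq V).

Definition saturated W T := D T <= codeg W T.

Definition unsaturated W f :=
  [forall T : {set V}, (T \subset f) ==> ~~ saturated W T].

Definition link W v f : R :=
  if (v \notin f) && unsaturated W f then w (v |: f) else 0.

Definition heavy W v := z <= total (link W v).

(** The list is scanned from its end: the tail is processed before the head. *)
Fixpoint run A s : {set V} -> R :=
  if s is v :: s' then
    let W := run A s' in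
    if (v \in A) && heavy W v then fun f => W f + link W v f else W
  else fun=> 0.

Fixpoint fingerprint A s : {set V} :=
  if s is v :: s' then
    if (v \in A) && heavy (run A s') v then v |: fingerprint A s'
    else fingerprint A s'
  else set0.

Fixpoint excluded A s : {set V} :=
  if s is v :: s' then
    if (v \notin A) && heavy (run A s') v then v |: excluded A s'
    else excluded A s'
  else set0.

Lemma fingerprint_sub A s : fingerprint A s \subset A.
Proof.
elim: s => [|v s IH] /=; first exact: sub0set.
by case: ifP => // /andP[vA _]; rewrite subUset sub1set vA.
Qed.

Lemma excluded_disjoint A s : [disjoint excluded A s & A].
Proof.
elim: s => [|v s IH] /=; first by rewrite disjoints_subset sub0set.
case: ifP => // /andP[vA _]; rewrite disjoints_subset subUset sub1set inE vA.
by rewrite -disjoints_subset.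
Qed.

(** Membership matters only at heavy vertices. One lying in [A] is in the fingerprint, hence in [B];
    one outside [A] is outside [B]. So both scans make the same choices. *)
Lemma run_between A B s : fingerprint A s \subset B -> B \subset A ->
  run B s = run A s /\ excluded B s = excluded A s.
Proof.
move=> + BA; elim: s => [|v s IH] //= FB.
have FsB : fingerprint A s \subset B.
  by apply: subset_trans FB; case: ifP => // _; apply: subsetUr.
have [-> ->] := IH FsB.
have [hv|] := boolP (heavy (run A s) v); last by rewrite !andbF.
rewrite !andbT in FB *; rewrite hv !andbT in FB *.
have [vA|vA] := boolP (v \in A).
  by have /subsetP/(_ v) := FB; rewrite vA !inE eqxx => ->.
by have -> : v \in B = false by apply: contraNF vA; apply/subsetP.
Qed.

Hypothesis w_ge0 : forall f, 0 <= w f.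

Lemma link_ge0 W v f : 0 <= link W v f.
Proof. by rewrite /link; case: ifP. Qed.

Lemma run_ge0 A s f : 0 <= run A s f.
Proof.
elim: s => //= v s IH; case: ifP => // _.
by rewrite addr_ge0 ?link_ge0.
Qed.

Lemma run_cons_le A v s f : run A s f <= run A (v :: s) f.
Proof. by rewrite /=; case: ifP => // _; rewrite lerDl link_ge0. Qed.

Lemma saturated_mono W W' T : (forall f, W f <= W' f) ->
  saturated W T -> saturated W' T.
Proof. by move=> le /le_trans; apply; apply: ler_sum. Qed.

Lemma unsaturated_mono W W' f : (forall f, W f <= W' f) ->
  unsaturated W' f -> unsaturated W f.
Proof.
move=> le /forallP h; apply/forallP => T; apply/implyP => Tf.
by apply: contra (implyP (h T) Tf); apply: saturated_mono.
Qed.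

Lemma unsaturated_sub W f f' : f \subset f' ->
  unsaturated W f' -> unsaturated W f.
Proof.
move=> ff' /forallP h; apply/forallP => T; apply/implyP => Tf.
exact: (implyP (h T) (subset_trans Tf ff')).
Qed.

(** A larger weight saturates more sets, so more of the link is discarded. *)
Lemma total_link_mono W W' v : (forall f, W f <= W' f) ->
  total (link W' v) <= total (link W v).
Proof.
move=> le; apply: ler_sum => f _; rewrite /link.
case: (v \notin f) => //=; case: ifP => [/(unsaturated_mono le) -> //|_].
by case: ifP.
Qed.

Lemma codeg_link W v T : v \notin T -> codeg (link W v) T <= codeg w (v |: T).
Proof.
move=> vT; rewrite /codeg.
rewrite [leRHS](reindex_onto (fun f => v |: f) (fun f => f :\ v)) /=; last first.
  by move=> f; rewrite subUset sub1set => /andP[vf _]; rewrite setD1K.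
rewrite [leLHS](bigID (fun f => v \notin f)) /= [X in _ + X]big1 ?addr0.
  rewrite [leLHS]big_mkcond [leRHS]big_mkcond /=; apply: ler_sum => f _.
  case: ifP => [/andP[Tf vf]|_]; last by case: ifP.
  rewrite setU1K // eqxx setUS // /link vf /=.
  by case: ifP.
by move=> f /andP[_ /negPn vf]; rewrite /link vf.
Qed.

Lemma codeg_link0 W v T : v \in T -> codeg (link W v) T = 0.
Proof.
by move=> vT; apply: big1 => f /subsetP/(_ v vT) vf; rewrite /link vf.
Qed.

Lemma codeg_link_saturated W v T : saturated W T -> codeg (link W v) T = 0.
Proof.
move=> sT; apply: big1 => f Tf; rewrite /link; case: ifP => // /andP[_ /forallP].
by move=> /(_ T); rewrite Tf sT.
Qed.

Lemma codegD W W' T : codeg (fun f => W f + W' f) T = codeg W T + codeg W' T.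
Proof. exact: big_split. Qed.

(* A saturated set gains no further codegree, so only the last jump counts. *)
Lemma codeg_run A s T (M : R) : 0 <= M -> 0 <= D T ->
  (forall v, v \notin T -> codeg w (v |: T) <= M) ->
  codeg (run A s) T <= D T + M.
Proof.
move=> M0 D0 hM; elim: s => [|v s IH] /=.
  by rewrite /codeg big1 // addr_ge0.
case: ifP => // _; rewrite codegD.
have [sT|] := boolP (saturated (run A s) T).
  by rewrite codeg_link_saturated // addr0.
rewrite -ltNge => /ltW le; apply: lerD => //.
have [vT|vT] := boolP (v \in T); first by rewrite codeg_link0.
exact: le_trans (codeg_link _ vT) (hM _ vT).
Qed.

Lemma totalD W W' : total (fun f => W f + W' f) = total W + total W'.
Proof. exact: big_split. Qed.

Lemma fingerprint_card A s : 0 <= z ->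
  #|fingerprint A s|%:R * z <= total (run A s).
Proof.
move=> z0; elim: s => [|v s IH] /=.
  by rewrite cards0 mul0r total_ge0.
case: ifP => // /andP[_ hv]; rewrite totalD.
apply: le_trans (lerD IH hv).
rewrite -[X in _ + X]mul1r -mulrDl ler_wpM2r // natr1 ler_nat cardsU1 -addn1 addnC.
by rewrite leq_add2l; case: (_ \notin _).
Qed.

(** Such a vertex was light when scanned, and its link only shrinks while the run grows
    afterwards. *)
Lemma light_outside A s v : v \in s -> v \notin fingerprint A s ->
  v \notin excluded A s -> total (link (run A s) v) <= z.
Proof.
elim: s => // u s IH; rewrite inE => vus vF vE.
have [vs|] := boolP (v \in s).
  apply: (le_trans (total_link_mono _ (run_cons_le A u s))).
  apply: IH => //.
    by apply: contra vF => /=; case: ifP => // _; rewrite !inE orbC => ->.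
  by apply: contra vE => /=; case: ifP => // _; rewrite !inE orbC => ->.
move=> vs; move: vus; rewrite (negPf vs) orbF => /eqP vu; subst u.
apply: (le_trans (total_link_mono _ (run_cons_le A v s))).
move: vF vE => /=; rewrite /heavy; case: (lerP z) => [hv|/ltW //].
by rewrite !andbT; case: (v \in A); rewrite /= !inE eqxx.
Qed.

Lemma run_support A s f : run A s f != 0 ->
  exists v, [/\ v \in A, v \notin f & w (v |: f) != 0].
Proof.
elim: s => /= [|v s IH]; first by rewrite eqxx.
case: ifP => // /andP[vA _]; have [->|/IH //] := eqVneq (run A s f) 0.
rewrite add0r /link; case: ifP => [/andP[vf _] wf|]; last by rewrite eqxx.
by exists v.
Qed.

(** Subsets of an unsaturated edge are unsaturated, so the edge survives in the link of each of its
    vertices, and it has at least one. *)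
Lemma sum_unsaturated W : (forall f, w f != 0 -> f != set0) ->
  \sum_(f : {set V} | unsaturated W f) w f <= \sum_v total (link W v).
Proof.
move=> wn.
have key v : \sum_(f : {set V} | unsaturated W f && (v \in f)) w f <= total (link W v).
  rewrite (reindex_onto (fun f => v |: f) (fun f => f :\ v)) /=; last first.
    by move=> f /andP[_ vf]; rewrite setD1K.
  rewrite big_mkcond /=; apply: ler_sum => f _; case: ifP; last first.
    by move=> _; apply: link_ge0.
  move=> /andP[/andP[hu _] /eqP hf]; rewrite /link.
  by rewrite (unsaturated_sub (subsetUr [set v] f) hu) -hf !inE eqxx.
apply: le_trans (ler_sum _ (fun v _ => key v)).
rewrite (exchange_big_dep (unsaturated W)) /=; last by move=> ? ? _ /andP[].
apply: ler_sum => f fu.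
have [->|wf] := eqVneq (w f) 0; first by rewrite big1.
have /set0Pn[v vf] := wn f wf.
rewrite (bigD1 v) /=; last by rewrite fu.
by rewrite lerDl sumr_ge0.
Qed.

(** An edge that is not unsaturated contains a saturated set and is charged to the codegree of that
    set. *)
Lemma sum_saturated W :
  total w <= \sum_(f : {set V} | unsaturated W f) w f + \sum_(T | saturated W T) codeg w T.
Proof.
rewrite /total (bigID (unsaturated W)) /= lerD2l.
rewrite /codeg (exchange_big_dep xpredT) //= big_mkcond /=.
apply: ler_sum => f _; case: ifP => [|_]; last exact: sumr_ge0.
move=> /forallPn[T]; rewrite negb_imply negbK => /andP[Tf sT].
by rewrite (bigD1 T) /=; [rewrite lerDl sumr_ge0|rewrite sT].
Qed.

End Process.

(** * Containers *)

Section ContainerStep.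
Variables (R : realFieldType) (V : finType).
Implicit Types (w W : {set V} -> R) (p c d : R) (A B I S T U f : {set V}).

Lemma excluded_support w (D : {set V} -> R) (z : R) A s v : 0 < z ->
  v \in excluded w D z A s -> exists2 f : {set V}, v \in f & w f != 0.
Proof.
move=> z0; elim: s => /= [|u s IH]; first by rewrite inE.
case: ifP => // /andP[_ hu]; rewrite !inE => /orP[/eqP ->|/IH //].
have: total (link w D (run w D z A s) u) != 0.
  by rewrite gt_eqF // (lt_le_trans z0 hu).
have [/existsP[f wf] _|/existsPn h] := boolP [exists f : {set V}, (u \in f) && (w f != 0)].
  by move/andP: wf => [uf wf]; exists f.
rewrite /total big1 ?eqxx // => f _; rewrite /link; case: ifP => // _.
by apply/eqP; have := h (u |: f); rewrite !inE eqxx negbK.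
Qed.

Definition independent w I := forall f : {set V}, f \subset I -> w f = 0.

(** The value at [set0] decides whether the auxiliary hypergraph counts as dense. Elsewhere the
    factor [2 ^+ s.+1] pays for the at most [2 ^+ s] subsets of an auxiliary edge, with a factor 2
    to spare. *)
Definition threshold s p c d T : R :=
  if T == set0 then p * #|V|%:R * d else 2 ^+ s.+1 * c * p ^+ #|T| * d.

Fixpoint avoided s p c d w B : {set V} :=
  if s is s'.+1 then
    let D := threshold s' p c d in
    let W := run w D (d / 4) B (enum V) in
    if saturated D W set0 then avoided s' p (2 ^+ s'.+1 * c + c) (p * d) W B
    else excluded w D (d / 4) B (enum V)
  else set0.

(** Here [d] plays the role of the average degree e/v and [U] is the current vertex set, while sizes
    stay measured against the fixed [V]. *)
Definition spread s p c d w U :=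
  [/\ forall f, 0 <= w f,
      forall f, w f != 0 -> #|f| = s /\ f \subset U,
      #|V|%:R * d <= total w
    & forall T, T != set0 -> codeg w T <= c * p ^+ #|T|.-1 * d].

Lemma total_link_le s p c d w U D W v : spread s p c d w U ->
  total (link w D W v) <= c * d.
Proof.
move=> [w0 _ _ wd]; rewrite -codeg_set0.
apply: le_trans (codeg_link _ w0 _ _) _; first by rewrite inE.
rewrite setU0; apply: le_trans (wd _ _) _.
  by apply/set0Pn; exists v; rewrite inE.
by rewrite cards1 expr0 mulr1.
Qed.

(** The total is the codegree of [set0], which overshoots its threshold by at most one link. *)
Lemma run_total_le s p c d w U I : 0 < p -> 0 < c -> 0 < d ->
  spread s.+1 p c d w U ->
  total (run w (threshold s p c d) (d / 4) I (enum V))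
    <= p * #|V|%:R * d + c * d.
Proof.
move=> p0 c0 d0 [w0 _ _ wd]; rewrite -codeg_set0.
have := @codeg_run _ _ w (threshold s p c d) (d / 4) w0 I (enum V) set0 (c * d).
rewrite /threshold eqxx; apply; rewrite ?mulr_ge0 ?ler0n ?(ltW p0) ?(ltW c0) ?(ltW d0) //.
move=> v _; rewrite setU0; apply: le_trans (wd _ _) _.
  by apply/set0Pn; exists v; rewrite inE.
by rewrite cards1 expr0 mulr1.
Qed.

(** Density is the saturation of [set0]. A codegree is at most its threshold plus one last jump,
    whence the new constant; [d] drops by the factor [p] along with the uniformity. *)
Lemma spread_run s p c d w U I : 0 < p -> 0 < c -> 0 < d ->
  spread s.+1 p c d w U ->
  let D := threshold s p c d in
  let W := run w D (d / 4) I (enum V) in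
  saturated D W set0 -> spread s p (2 ^+ s.+1 * c + c) (p * d) W U.
Proof.
move=> p0 c0 d0 [w0 ws wt wd] D W sat.
have A0 : 0 <= 2 ^+ s.+1 * c by rewrite mulr_ge0 ?exprn_ge0 // ltW.
split.
- by move=> f; apply: run_ge0.
- move=> f /run_support[v [_ vf /ws [cf fU]]]; split.
    by move: cf; rewrite cardsU1 vf add1n => -[].
  by apply: subset_trans fU; apply: subsetUr.
- move: sat; rewrite /saturated /D /threshold eqxx codeg_set0.
  by rewrite mulrCA mulrA.
- move=> T T0.
  have pE : p ^+ #|T| = p * p ^+ #|T|.-1 by rewrite -exprS prednK // card_gt0.
  have -> : (2 ^+ s.+1 * c + c) * p ^+ #|T|.-1 * (p * d)
      = D T + c * p ^+ #|T| * d.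
    by rewrite /D /threshold (negPf T0) pE; ring.
  have pT : 0 <= p ^+ #|T| by rewrite exprn_ge0 // ltW.
  apply: codeg_run => //.
  + by rewrite !mulr_ge0 // ltW.
  + by rewrite /D /threshold (negPf T0) mulr_ge0 ?(ltW d0) // mulr_ge0.
  + move=> v vT; apply: le_trans (wd _ _) _.
      by apply/set0Pn; exists v; rewrite !inE eqxx.
    by rewrite cardsU1 vT.
Qed.

(** A saturated [T] is nonempty here, so [codeg w T] is at most [codeg W T] divided by
    [2 ^+ s.+1 * p]. The latter codegrees sum to at most [2 ^+ s * total W], and [total W] is below
    the threshold of [set0]. *)
Lemma sum_saturated_le s p c d w U I : 0 < p -> 0 < c -> 0 < d ->
  spread s.+1 p c d w U ->
  let D := threshold s p c d in
  let W := run w D (d / 4) I (enum V) in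
  ~~ saturated D W set0 ->
  \sum_(T | saturated D W T) codeg w T <= #|V|%:R * d / 2.
Proof.
move=> p0 c0 d0 [w0 ws wt wd] D W unsat.
have W0 f : 0 <= W f by apply: run_ge0.
have tW : total W < p * #|V|%:R * d.
  by move: unsat; rewrite /saturated /D /threshold eqxx codeg_set0 -ltNge.
have Ws f : W f != 0 -> (#|f| <= s)%N.
  by move=> /run_support[v [_ vf /ws [+ _]]]; rewrite cardsU1 vf add1n => -[->].
have P0 : 0 < 2 ^+ s.+1 * p by rewrite mulr_gt0 ?exprn_gt0.
rewrite -(ler_pM2l P0) mulr_sumr.
have step T : saturated D W T -> 2 ^+ s.+1 * p * codeg w T <= codeg W T.
  move=> sT; have [T0|T0] := eqVneq T set0; first by rewrite T0 in sT; rewrite sT in unsat.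
  apply: le_trans sT; rewrite /D /threshold (negPf T0).
  apply: le_trans (ler_wpM2l (ltW P0) (wd _ T0)) _.
  have pE : p ^+ #|T| = p * p ^+ #|T|.-1 by rewrite -exprS prednK // card_gt0.
  by rewrite pE le_eqVlt; apply/orP; left; apply/eqP; ring.
apply: le_trans (ler_sum _ step) _.
have le1 : \sum_(T | saturated D W T) codeg W T <= \sum_T codeg W T.
  rewrite big_mkcond; apply: ler_sum => T _; case: ifP => // _.
  exact: codeg_ge0.
apply: le_trans le1 _; apply: le_trans (sum_codeg W0 Ws) _.
apply: le_trans (ler_wpM2l _ (ltW tW)) _; first by rewrite exprn_ge0.
by rewrite exprS le_eqVlt; apply/orP; left; apply/eqP; field.
Qed.

(** Of the weight [N * d], saturated sets take at most a half, light vertices at most a quarter, and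
    each vertex of [F] or [X] at most [c * d]. As [F] takes at most an eighth, [X] must carry the
    remaining eighth. *)
Lemma excluded_card s p c d w U I : 0 < p -> 0 < c -> 0 < d ->
  p * (32 * c) <= 1 -> spread s.+1 p c d w U ->
  let D := threshold s p c d in
  let W := run w D (d / 4) I (enum V) in
  ~~ saturated D W set0 ->
  (8 * c)^-1 * #|V|%:R <= #|excluded w D (d / 4) I (enum V)|%:R.
Proof.
move=> p0 c0 d0 pc sp D W unsat; have [w0 ws wt wd] := sp.
set F := fingerprint w D (d / 4) I (enum V).
set X := excluded _ _ _ _ _.
set N : R := #|V|%:R in wt *.
have tW : total W < p * N * d.
  by move: unsat; rewrite /saturated /D /threshold eqxx codeg_set0 -ltNge.
have F4 : #|F|%:R <= 4 * p * N.
  have := fingerprint_card w D I (enum V) (divr_ge0 (ltW d0) (ler0n R 4)).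
  rewrite -/W -/F => h.
  have {}h := le_lt_trans h tW.
  rewrite -(ler_pM2r d0); apply: ltW; lra.
have hs := sum_saturated_le p0 c0 d0 sp unsat.
have hu : \sum_(f : {set V} | unsaturated D W f) w f
    <= N * (d / 4) + (#|F|%:R + #|X|%:R) * (c * d).
  apply: le_trans (sum_unsaturated D w0 W _) _.
    by move=> f /ws [cf _]; rewrite -card_gt0 cf.
  rewrite (bigID (mem (F :|: X))) /= addrC; apply: lerD.
    have h v : v \notin F :|: X -> total (link w D W v) <= d / 4.
      rewrite inE negb_or => /andP[vF vX].
      by apply: light_outside; rewrite ?mem_enum.
    apply: le_trans (ler_sum _ h) _; rewrite sumr_const -[leLHS]mulr_natl.
    by rewrite ler_wpM2r ?divr_ge0 ?(ltW d0) // ler_nat max_card.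
  apply: le_trans (ler_sum _ (fun v _ => total_link_le D W v sp)) _.
  rewrite sumr_const -[leLHS]mulr_natl ler_wpM2r ?mulr_ge0 ?(ltW c0) ?(ltW d0) //.
  by rewrite -natrD ler_nat cardsU leq_subr.
have hw := sum_saturated D w0 W.
have h1 : N * d <= N * d / 2 + N * d / 4 + (#|F|%:R + #|X|%:R) * c * d by lra.
have N0 : 0 <= N by rewrite ler0n.
have h2 : N <= N / 2 + N / 4 + (#|F|%:R + #|X|%:R) * c.
  by rewrite -(ler_pM2r d0); lra.
have h3 : #|F|%:R * c <= N / 8.
  apply: le_trans (ler_wpM2r (ltW c0) F4) _.
  by have := ler_wpM2r N0 pc; lra.
rewrite mulrC ler_pdivrMr ?mulr_gt0 //; lra.
Qed.

End ContainerStep.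

(* The answer only depends on [I] through a small certificate [S]: every set
   between [S] and [I] yields the same avoided set. *)
Lemma avoidedP (R : realFieldType) (s : nat) (c : R) : 0 < c ->
  exists delta K p0 : R, [/\ 0 < delta, 0 <= K, 0 < p0 &
  forall (V : finType) (p d : R) (w : {set V} -> R) (U I : {set V}),
    0 < p -> p <= p0 -> 1 <= p * #|V|%:R -> 0 < d ->
    spread s p c d w U -> independent w I ->
    [/\ avoided s p c d w I \subset U,
        [disjoint avoided s p c d w I & I],
        delta * #|V|%:R <= #|avoided s p c d w I|%:R &
        exists S : {set V}, [/\ S \subset I, #|S|%:R <= K * (p * #|V|%:R) &
          forall B : {set V}, S \subset B -> B \subset I ->
            avoided s p c d w B = avoided s p c d w I]]].
Proof.
elim: s c => [|s IH] c c0.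
  (* Any constants do: the only possible edge is [set0], whose weight vanishes by independence,
     while the total weight is positive. *)
  exists 1, 0, 1; split=> // V p d w U I p0 _ pN d0 [w0 ws wt _] wI.
  have : 0 < total w.
    apply: lt_le_trans wt; rewrite mulr_gt0 //.
    by rewrite -(pmulr_rgt0 _ p0); apply: lt_le_trans pN.
  rewrite /total big1 ?ltxx // => f _.
  have [//|/[dup] wf /ws [/eqP]] := eqVneq (w f) 0.
  by rewrite cards_eq0 => /eqP f0 _; rewrite f0 wI ?sub0set.
have c'0 : 0 < 2 ^+ s.+1 * c + c by rewrite addr_gt0 // mulr_gt0 ?exprn_gt0.
have [dl [K [p0 [dl0 K0 p00 {}IH]]]] := IH _ c'0.
(* Each minimum covers both branches, the sparse one through [excluded_card]; [4 * (1 + c)] bounds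
   the fingerprint, using [1 <= p * #|V|]. *)
exists (Num.min (8 * c)^-1 dl), (4 * (1 + c) + K), (Num.min (32 * c)^-1 p0).
split; first by rewrite lt_min invr_gt0 mulr_gt0.
- by rewrite addr_ge0 // mulr_ge0 // addr_ge0 // ltW.
- by rewrite lt_min invr_gt0 mulr_gt0.
move=> V p d w U I pp; rewrite le_min => /andP[pc ple] pN d0 sp wI.
have [w0 ws wt wd] := sp.
rewrite [avoided _ _ _ _ _ I]/=.
set D := threshold s p c d; set W := run w D (d / 4) I (enum V).
set F := fingerprint w D (d / 4) I (enum V).
have F_le : #|F|%:R <= 4 * (1 + c) * (p * #|V|%:R).
  have := fingerprint_card w D I (enum V) (divr_ge0 (ltW d0) (ler0n R 4)).
  rewrite -/F => h.
  have {}h := le_trans h (run_total_le I pp c0 d0 sp).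
  have h2 : #|F|%:R <= 4 * (p * #|V|%:R + c) by rewrite -(ler_pM2r d0); lra.
  by have := ler_wpM2l (ltW c0) pN; lra.
have FI : F \subset I by apply: fingerprint_sub.
have N0 : 0 <= #|V|%:R :> R by rewrite ler0n.
have pN0 : 0 <= p * #|V|%:R := le_trans ler01 pN.
have KpN0 : 0 <= K * (p * #|V|%:R) by rewrite mulr_ge0.
case: ifP => [sat|/negbT unsat]; last first.
  split.
  - apply/subsetP => v /excluded_support[|f vf /ws[_ /subsetP]]; last exact.
    by rewrite divr_gt0.
  - exact: excluded_disjoint.
  - apply: le_trans (excluded_card pp c0 d0 _ sp unsat); last first.
      by rewrite -ler_pdivlMr ?mulr_gt0 // mul1r.
    by rewrite ler_wpM2r // ge_min lexx.
  - exists F; split=> //; first by rewrite mulrDl -[leLHS]addr0 lerD.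
    move=> B FB BI /=; have [-> ->] := run_between FB BI.
    by rewrite -/W (negPf unsat).
have pd0 : 0 < p * d by rewrite mulr_gt0.
have sp' := spread_run pp c0 d0 sp sat.
have WI : independent W I.
  move=> f fI; apply/eqP/negPn/negP => /run_support[v [vI _ /eqP]]; apply.
  by apply: wI; rewrite subUset sub1set vI.
have [hU hd hc [S [SI SK hS]]] := IH V p _ W U I pp ple pN pd0 sp' WI.
split=> //.
  by apply: le_trans hc; rewrite ler_wpM2r // ge_min lexx orbT.
(* [F] fixes [W] and the branch taken, and [S] fixes the recursive call. *)
exists (F :|: S); split; first by rewrite subUset FI.
  rewrite mulrDl; apply: le_trans (lerD F_le SK).
  by rewrite -natrD ler_nat cardsU leq_subr.
move=> B; rewrite subUset => /andP[FB SB] BI.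
by rewrite /= (run_between FB BI).1 -/D -/W sat; apply: hS.
Qed.

(** * Containers obtained by iterating the avoided set *)

Section Containers.
Variables (R : archiRealFieldType) (V : finType).
Implicit Types (E : {set {set V}}) (U I S B T f : {set V}).

Definition edges_in E U := [set f in E | f \subset U].

Definition edge_weight E U f : R := (f \in edges_in E U)%:R.

Lemma edge_weight_neq0 E U f : (edge_weight E U f != 0) = (f \in edges_in E U).
Proof. by rewrite /edge_weight pnatr_eq0 eqb0 negbK. Qed.

Lemma total_edge_weight E U : total (edge_weight E U) = #|edges_in E U|%:R.
Proof.
rewrite -sum1_card natr_sum big_mkcond /=; apply: eq_bigr => f _.
by rewrite /edge_weight; case: (f \in _).
Qed.

Lemma codeg_edge_weight E U T :
  codeg (edge_weight E U) T <= #|[set f in E | T \subset f]|%:R.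
Proof.
rewrite -sum1_card natr_sum /codeg big_mkcond [leRHS]big_mkcond /=.
apply: ler_sum => f _; rewrite /edge_weight !inE; case: (T \subset f) => //=.
  by case: (f \in E); case: (f \subset U).
by case: ifP.
Qed.

Definition shrink E k (p c d a : R) B U :=
  if a <= #|edges_in E U|%:R then U :\: avoided k p c d (edge_weight E U) B
  else U.

End Containers.

(** Start from all vertices and delete the avoided set as long as more than the allowed number of
    edges remains or is attained. Each deletion removes a fixed fraction of [V], so boundedly many
    rounds suffice, and their certificates are united. *)
Lemma containers (R : archiRealFieldType) (k : nat) (c eps : R) :
  0 < c -> 0 < eps -> exists K p0 : R, [/\ 0 <= K, 0 < p0 &
  forall (V : finType) (E : {set {set V}}) (p : R),
    0 < p -> p <= p0 -> 1 <= p * #|V|%:R -> (0 < #|E|)%N ->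
    (forall f : {set V}, f \in E -> #|f| = k) ->
    (forall T : {set V}, T != set0 ->
      #|[set f in E | T \subset f]|%:R
        <= c * p ^+ #|T|.-1 * (#|E|%:R / #|V|%:R)) ->
    exists F : {set V} -> {set V}, forall I : {set V},
      (forall f : {set V}, f \in E -> ~~ (f \subset I)) ->
      [/\ I \subset F I, #|edges_in E (F I)|%:R <= eps * #|E|%:R &
        exists S : {set V}, [/\ S \subset I, #|S|%:R <= K * (p * #|V|%:R) &
          forall B : {set V}, S \subset B -> B \subset I -> F B = F I]]].
Proof.
(* The current set may span only a fraction [eps] of the edges, so degrees relative to the new [d]
   worsen by [1 / eps]. *)
move=> c0 e0; have ce0 : 0 < c / eps by rewrite divr_gt0.
have [dl [K [p0 [dl0 K0 p00 avP]]]] := avoidedP k ce0.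
pose m := Num.bound dl^-1.
have dlm : 1 < m%:R * dl.
  rewrite -ltr_pdivrMr // mul1r; apply: le_lt_trans (archi_boundP _).
    exact: lexx.
  by rewrite invr_ge0 ltW.
exists (m%:R * K), p0; split=> //; first by rewrite mulr_ge0 ?ler0n.
move=> V E p pp ple pN E0 Ek Edeg.
have N0 : 0 < #|V|%:R :> R.
  by rewrite -(pmulr_rgt0 _ pp); apply: lt_le_trans pN.
have E0R : 0 < #|E|%:R :> R by rewrite ltr0n.
pose a := eps * #|E|%:R; pose d := a / #|V|%:R.
have d0 : 0 < d by rewrite divr_gt0 // mulr_gt0.
pose F j B := iter j (shrink E k p (c / eps) d a B) setT.
exists (F m) => I indI.
suff key j : [/\ I \subset F j I,
    #|edges_in E (F j I)|%:R < a \/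
    #|F j I|%:R <= #|V|%:R - j%:R * (dl * #|V|%:R) &
    exists S : {set V}, [/\ S \subset I, #|S|%:R <= j%:R * K * (p * #|V|%:R) &
          forall B : {set V}, S \subset B -> B \subset I -> F j B = F j I]].
  (* If all [m] rounds had deleted vertices, the size would be negative, because [m * dl > 1]. *)
  have [IF [/ltW //|le] cert] := key m; split=> //.
  have : 0 <= #|F m I|%:R :> R by rewrite ler0n.
  move=> /le_trans/(_ le); rewrite mulrA -{1}[#|V|%:R]mul1r -mulrBl.
  by rewrite pmulr_lge0 // subr_ge0 leNgt dlm.
elim: j => [|j [IF dich [S [SI SK hS]]]].
  split; first exact: subsetT.
    by right; rewrite /F /= cardsT mul0r subr0.
  by exists set0; split; rewrite ?sub0set // cards0 !mul0r.
have FE B : F j.+1 B = shrink E k p (c / eps) d a B (F j B) by [].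
set U := F j I in IF dich hS FE *.
have [big|small] := boolP (a <= #|edges_in E U|%:R); last first.
  have FI : F j.+1 I = U by rewrite FE /shrink (negPf small).
  split; rewrite ?FI //; first by left; rewrite ltNge.
  exists S; split=> //.
    apply: le_trans SK _; rewrite ler_wpM2r ?(le_trans ler01) //.
    by rewrite ler_wpM2r // ler_nat.
  by move=> B SB BI; rewrite FE hS // /shrink (negPf small).
have sp : spread k p (c / eps) d (edge_weight R E U) U.
  split.
  - by move=> f; rewrite ler0n.
  - by move=> f; rewrite edge_weight_neq0 inE => /andP[/Ek].
  - by rewrite total_edge_weight /d mulrC divfK // gt_eqF.
  - move=> T T0; apply: le_trans (codeg_edge_weight _ _ _ _) _.
    apply: le_trans (Edeg T T0) _; rewrite /d /a le_eqVlt; apply/orP; left.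
    by apply/eqP; field; rewrite !gt_eqF.
have indW : independent (edge_weight R E U) I.
  move=> f fI; apply/eqP; rewrite -[_ == _]negbK edge_weight_neq0 inE.
  by apply: contraL fI => /andP[/indI].
have [XU XI Xc [S' [S'I S'K hS']]] :=
  avP V p d (edge_weight R E U) U I pp ple pN d0 sp indW.
have FI : F j.+1 I = U :\: avoided k p (c / eps) d (edge_weight R E U) I.
  by rewrite FE /shrink big.
split; rewrite ?FI.
- by rewrite subsetD IF disjoint_sym.
- right; case: dich => [|le]; first by rewrite ltNge big.
  rewrite cardsD (setIidPr XU) natrB ?subset_leq_card // -natr1.
  by rewrite mulrDl mul1r opprD addrA; apply: lerB.
exists (S :|: S'); split; first by rewrite subUset SI.
  rewrite -natr1 !mulrDl mul1r; apply: le_trans (lerD SK S'K).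
  by rewrite -natrD ler_nat cardsU leq_subr.
move=> B; rewrite subUset => /andP[SB S'B] BI.
by rewrite FE hS // /shrink big hS'.
Qed.

(** * Random vertex subsets *)

Section RandomSubset.
Variables (R : realType) (V : finType).
Implicit Types (q : R) (S W Y : {set V}).

Lemma sum_prod_subset (F G : V -> R) :
  \sum_(W : {set V}) \prod_x (if x \in W then F x else G x)
    = \prod_x (F x + G x).
Proof. by rewrite bigA_distr; apply: eq_bigl. Qed.

Lemma keep_prob_total q : \sum_(W : {set V}) keep_prob q W = 1.
Proof.
rewrite (sum_prod_subset (fun=> q) (fun=> 1 - q)) big1 // => x _.
by rewrite /= addrC subrK.
Qed.

Lemma keep_prob_ge0 q W : 0 <= q <= 1 -> 0 <= keep_prob q W.
Proof.
move=> /andP[q0 q1]; apply: prodr_ge0 => x _.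
by case: ifP; rewrite ?subr_ge0.
Qed.

(** Forbidden choices get factor 0, so the sum factors over vertices; a vertex of [Y] outside [S]
    contributes [1 - q <= expR (- q)]. *)
Lemma keep_prob_between q S Y : 0 <= q <= 1 ->
  \sum_(W : {set V} | (S \subset W) && [disjoint W & Y]) keep_prob q W
    <= q ^+ #|S| * expR (- (q * #|Y|%:R)).
Proof.
move=> /andP[q0 q1].
pose g x : R := if x \in Y then 0 else q.
pose h x : R := if x \in S then 0 else 1 - q.
have g0 x : 0 <= g x by rewrite /g; case: ifP.
have h0 x : 0 <= h x by rewrite /h; case: ifP => // _; rewrite subr_ge0.
apply: (@le_trans _ _ (\sum_(W : {set V}) \prod_x (if x \in W then g x else h x))).
  rewrite big_mkcond; apply: ler_sum => W _; case: ifP => [/andP[SW WY]|_].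
    apply: ler_prod => x _; case: ifP => xW.
      by rewrite /g q0 (disjointFr WY xW) lexx.
    by rewrite /h subr_ge0 q1 (contraFF (subsetP SW x) xW) lexx.
  by apply: prodr_ge0 => x _; case: ifP.
rewrite sum_prod_subset -mulNr.
have -> : q ^+ #|S| = \prod_x (if x \in S then q else 1).
  by rewrite -big_mkcond /= prodr_const.
have -> : expR (- q * #|Y|%:R) = \prod_x (if x \in Y then expR (- q) else 1).
  by rewrite -big_mkcond /= prodr_const mulrC expRM_natl.
rewrite -big_split /=; apply: ler_prod => x _; rewrite addr_ge0 //=.
have e1 : 1 - q <= expR (- q) := expR_ge1Dx (- q).
have e0 : 0 < expR (- q) := expR_gt0 (- q).
rewrite /g /h; case: ifP => xY; case: ifP => xS.
- by rewrite addr0 mulr_ge0 // ltW.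
- by rewrite add0r mul1r.
- by rewrite addr0 mulr1.
- by rewrite mulr1 addrC subrK.
Qed.

(** An [r]-tuple of vertex sets is encoded by the set of indices at each vertex, so that sums over
    tuples factor over vertices; [marked A] is the union of the tuple. *)
Definition marked r (A : {ffun V -> {set 'I_r}}) : {set V} :=
  [set v | A v != set0].

Definition mark r (A : {ffun V -> {set 'I_r}}) i : {set V} :=
  [set v | i \in A v].

(** The sum factors, and each vertex contributes at most [1 + 2 ^+ r * x]. *)
Lemma sum_marked r (x : R) : 0 <= x ->
  \sum_(A : {ffun V -> {set 'I_r}}) x ^+ #|marked A|
    <= expR (2 ^+ r * x * #|V|%:R).
Proof.
move=> x0.
have -> : \sum_(A : {ffun V -> {set 'I_r}}) x ^+ #|marked A| =
    \sum_(A : {ffun V -> {set 'I_r}}) \prod_v (if A v != set0 then x else 1).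
  apply: eq_bigr => A _; rewrite -big_mkcond /= -prodr_const.
  by apply: eq_bigl => v; rewrite inE.
rewrite -(bigA_distr_bigA (fun _ a => if a != set0 then x else 1)) /=.
rewrite prodr_const mulrC expRM_natl.
apply: lerXn2r; rewrite ?nnegrE ?(ltW (expR_gt0 _)) //.
  by apply: sumr_ge0 => a _; case: ifP.
apply: le_trans (expR_ge1Dx _).
rewrite (bigD1 set0) //= eqxx /= lerD2l.
apply: (@le_trans _ _ (\sum_(a : {set 'I_r}) x)); last first.
  rewrite sumr_const -[leLHS]mulr_natl -natrX.
  by rewrite -cardsT -powersetT card_powerset cardsT card_ord.
by rewrite big_mkcond; apply: ler_sum => a _; case: (a != set0).
Qed.

End RandomSubset.

(** * Colourings, containers and non-Ramsey vertex subsets *)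

Section Colourings.
Variables (R : realType) (k r : nat) (H : hypergraph k).
Hypothesis r_gt0 : (0 < r)%N.

Let E := edges H.
Let N : R := (nvert H)%:R.

(** Colour each vertex by a container holding it, and uncovered ones by the default [i0]. A
    monochromatic edge lies in a container or meets [Y]; the containers supply at most half of the
    guaranteed edges, so [Y] must meet the rest. *)
Lemma uncovered_card (c eps : R) (C : 'I_r -> {set vert H}) :
  0 < c -> (0 < nedge H)%N -> 0 < N -> supersaturated r eps H ->
  (forall v, #|[set f in E | [set v] \subset f]|%:R <= c * (#|E|%:R / N)) ->
  (forall i, #|edges_in E (C i)|%:R <= eps / (2 * r%:R) * #|E|%:R) ->
  eps / (2 * c) * N <= #|~: \bigcup_i C i|%:R.
Proof.
move=> c0 E0 N0 sat deg small; set Y := ~: _.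
pose i0 := Ordinal r_gt0.
pose chi : {ffun vert H -> 'I_r} := [ffun v => odflt i0 [pick i | v \in C i]].
have chiP v : v \notin Y -> v \in C (chi v).
  rewrite !inE negbK => /bigcupP[i _ vi]; rewrite ffunE.
  by case: pickP => [//|/(_ i)]; rewrite vi.
have E0R : 0 < #|E|%:R :> R by rewrite ltr0n.
have sub : mono_edges chi \subset
    (\bigcup_i edges_in E (C i)) :|: \bigcup_(v in Y) [set f in E | [set v] \subset f].
  apply/subsetP => f; rewrite inE => /andP[fE /existsP[i /forallP fi]].
  have [fY|/pred0Pn[v /andP[vf vY]]] := boolP [disjoint f & Y].
    apply/setUP; left; apply/bigcupP; exists i => //; rewrite inE fE.
    apply/subsetP => v vf; have := fi v; rewrite vf => /eqP <-.
    by apply: chiP; rewrite (disjointFr fY vf).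
  by apply/setUP; right; apply/bigcupP; exists v => //; rewrite inE fE sub1set.
have le1 : (#|mono_edges chi| <=
    \sum_i #|edges_in E (C i)| + \sum_(v in Y) #|[set f in E | [set v] \subset f]|)%N.
  apply: leq_trans (subset_leq_card sub) _.
  apply: leq_trans (_ : _ <= #|\bigcup_i edges_in E (C i)| +
     #|\bigcup_(v in Y) [set f in E | [set v] \subset f]|)%N _.
    by rewrite cardsU leq_subr.
  by apply: leq_add; apply: card_big_setU.
have h := sat chi; move: le1; rewrite -(ler_nat R) natrD !natr_sum => le1.
have le2 : \sum_i #|edges_in E (C i)|%:R <= eps / 2 * #|E|%:R :> R.
  apply: le_trans (ler_sum _ (fun i _ => small i)) _.
  rewrite sumr_const card_ord -[leLHS]mulr_natl le_eqVlt; apply/orP; left.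
  by apply/eqP; field; rewrite pnatr_eq0 -lt0n.
have le3 : \sum_(v in Y) #|[set f in E | [set v] \subset f]|%:R
    <= #|Y|%:R * (c * (#|E|%:R / N)) :> R.
  apply: le_trans (ler_sum _ (fun v _ => deg v)) _.
  by rewrite sumr_const -[leLHS]mulr_natl.
have le4 : eps / 2 * #|E|%:R <= #|Y|%:R * c / N * #|E|%:R.
  rewrite /nedge -/E in h.
  have -> : #|Y|%:R * c / N * #|E|%:R = #|Y|%:R * (c * (#|E|%:R / N)) by ring.
  lra.
rewrite ler_pM2r // ler_pdivlMr // in le4.
rewrite -(ler_pM2r c0); apply: le_trans le4.
by rewrite le_eqVlt; apply/orP; left; apply/eqP; field; rewrite gt_eqF.
Qed.

Lemma not_ramseyP (W : {set vert H}) : ~~ ramsey r (induced W) ->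
  exists I : 'I_r -> {set vert H},
    \bigcup_i I i = W /\ forall i f, f \in E -> ~~ (f \subset I i).
Proof.
move=> /forallPn[chi]; rewrite negbK => /eqP mono0.
exists (fun i => [set val x | x in [set x | chi x == i]]); split.
  apply/setP => v; apply/bigcupP/idP => [[i _ /imsetP[x _ ->]]|vW].
    exact: valP.
  exists (chi (exist _ v vW)) => //; apply/imsetP.
  by exists (exist _ v vW); rewrite ?inE.
move=> i f fE; apply/negP => /subsetP fI.
(* The edge [f] pulled back to the subtype on which [chi] is defined. *)
pose g : {set {x : vert H | x \in W}} := [set x | val x \in f].
have gf : [set val x | x in g] = f.
  apply/setP => v; apply/imsetP/idP => [[x + ->]|vf]; first by rewrite inE.
  by have /imsetP[x _ vx] := fI v vf; exists x; rewrite // inE -vx.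
have : g \in mono_edges chi.
  rewrite !inE gf fE; apply/existsP; exists i; apply/forallP => x.
  apply/implyP; rewrite inE => /fI /imsetP[y + /val_inj ->].
  by rewrite inE.
by rewrite mono0 inE.
Qed.

End Colourings.

Lemma card_edges_maxdeg (k : nat) (H : hypergraph k) (T : {set vert H}) :
  (#|[set f in edges H | T \subset f]| <= maxdeg H #|T|)%N.
Proof.
exact: (@leq_bigmax_cond _ _ (fun S : {set vert H} =>
  #|[set f in edges H | S \subset f]|)).
Qed.

(* A non-Ramsey vertex subset [W] is captured by the certificates of its colour
   classes, encoded as the set [A v] of colours whose certificate contains [v]. *)
Lemma not_ramsey_marked (R : realType) (r k : nat) (c eps : R) :
  (0 < r)%N -> 0 < c -> 0 < eps ->
  exists K p0 : R, [/\ 0 <= K, 0 < p0 &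
  forall (H : hypergraph k) (p : R), 0 < p -> p <= p0 ->
    1 <= p * (nvert H)%:R -> (0 < nedge H)%N ->
    (forall l : nat, (1 <= l <= k)%N ->
      (maxdeg H l)%:R <= c * p ^+ l.-1 * ((nedge H)%:R / (nvert H)%:R)) ->
    supersaturated r eps H ->
    exists Y : {ffun vert H -> {set 'I_r}} -> {set vert H},
      forall W : {set vert H}, ~~ ramsey r (induced W) ->
      exists A : {ffun vert H -> {set 'I_r}},
        [/\ marked A \subset W, [disjoint W & Y A],
            #|marked A|%:R <= K * (p * (nvert H)%:R)
          & eps / (2 * c) * (nvert H)%:R <= #|Y A|%:R]].
Proof.
move=> r0 c0 e0; have r0R : 0 < r%:R :> R by rewrite ltr0n.
have e'0 : 0 < eps / (2 * r%:R) by rewrite divr_gt0 // mulr_gt0.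
have [K [p0 [K0 p00 cont]]] := containers k c0 e'0.
exists (r%:R * K), p0; split=> //; first by rewrite mulr_ge0 // ltW.
move=> H p pp ple pN E0 deg sat.
have N0 : 0 < (nvert H)%:R :> R.
  by rewrite -(pmulr_rgt0 _ pp); apply: lt_le_trans pN.
have degT (T : {set vert H}) : T != set0 ->
    #|[set f in edges H | T \subset f]|%:R
      <= c * p ^+ #|T|.-1 * ((nedge H)%:R / (nvert H)%:R).
  move=> T0; have [Tk|kT] := leqP #|T| k.
    apply: le_trans (deg _ _); first by rewrite ler_nat card_edges_maxdeg.
    by rewrite card_gt0 T0.
  have -> : [set f in edges H | T \subset f] = set0.
    apply/setP => f; rewrite !inE; apply/negP => /andP[/edges_uniform fk].
    by move=> /subset_leq_card; rewrite fk leqNgt kT.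
  by rewrite cards0 mulr_ge0 ?divr_ge0 ?ler0n // mulr_ge0 ?exprn_ge0 // ltW.
have [F FP] := cont _ _ p pp ple pN E0 (@edges_uniform _ H) degT.
(* The containers are recomputed from the certificates alone, so their uncovered set depends only on
   [A]. *)
exists (fun A => ~: \bigcup_i F (mark A i)) => W /not_ramseyP[I [IW indI]].
have /fin_all_exists[S SP] i : exists S : {set vert H},
    [/\ S \subset I i, #|S|%:R <= K * (p * (nvert H)%:R), F S = F (I i),
        I i \subset F S & #|edges_in (edges H) (F S)|%:R
          <= eps / (2 * r%:R) * #|edges H|%:R].
  have [IF Fs [S [SI SK hS]]] := FP (I i) (indI i).
  by exists S; rewrite hS.
pose A := [ffun v => [set i | v \in S i]].
have markA i : mark A i = S i by apply/setP => v; rewrite !inE ffunE inE.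
have AS : marked A \subset \bigcup_i S i.
  apply/subsetP => v; rewrite inE ffunE => /set0Pn[i]; rewrite inE => vS.
  by apply/bigcupP; exists i.
have bigF : \bigcup_i F (mark A i) = \bigcup_i F (S i).
  by apply: eq_bigr => i _; rewrite markA.
exists A; rewrite bigF; split.
- apply: subset_trans AS _; rewrite -IW; apply/bigcupsP => i _.
  by have [SI _ _ _ _] := SP i; apply: subset_trans SI (bigcup_sup i _).
- rewrite disjoints_subset setCK -IW; apply/bigcupsP => i _.
  by have [_ _ _ IF _] := SP i; apply: subset_trans IF (bigcup_sup i _).
- apply: (@le_trans _ _ (\sum_i #|S i|%:R)).
    rewrite -natr_sum ler_nat; apply: leq_trans (subset_leq_card AS) _.
    exact: card_big_setU.
  apply: (@le_trans _ _ (\sum_(i < r) K * (p * (nvert H)%:R))).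
    by apply: ler_sum => i _; have [] := SP i.
  by rewrite sumr_const card_ord -[leLHS]mulr_natl mulrA.
- apply: uncovered_card => // [v|i]; last by have [] := SP i.
  apply: le_trans (degT [set v] _) _.
    by apply/set0Pn; exists v; rewrite inE.
  by rewrite cards1 expr0 mulr1.
Qed.

(** * The failure probability *)

Lemma prob_not_ramsey (R : realType) (r k : nat) (H : hypergraph k) (q : R) :
  \sum_(W : {set vert H} | ~~ ramsey r (induced W)) keep_prob q W
    = 1 - prob_vrandom H q (@ramsey k r).
Proof.
rewrite -(keep_prob_total (vert H) q).
rewrite [X in X - _](bigID (fun W => ramsey r (induced W))) /=.
by rewrite /prob_vrandom [RHS]addrC addKr.
Qed.

Lemma prob_ramsey_le1 (R : realType) (r k : nat) (H : hypergraph k) (q : R) :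
  0 <= q <= 1 -> prob_vrandom H q (@ramsey k r) <= 1.
Proof.
move=> q01; rewrite -subr_ge0 -prob_not_ramsey; apply: sumr_ge0 => W _.
exact: keep_prob_ge0.
Qed.

(* Union bound over [A]; the factor [expR (a * (L - #|marked A|)) >= 1] turns the
   cardinality constraint on [marked A] into a product over vertices. *)
Lemma union_bound_marked (R : realType) (V : finType) (r : nat) (q a L y : R)
    (bad : pred {set V}) (Y : {ffun V -> {set 'I_r}} -> {set V}) :
  0 <= q <= 1 -> 0 <= a ->
  (forall W : {set V}, bad W -> exists A : {ffun V -> {set 'I_r}},
     [/\ marked A \subset W, [disjoint W & Y A],
         #|marked A|%:R <= L & y <= #|Y A|%:R]) ->
  \sum_(W | bad W) keep_prob q W
    <= expR (a * L - q * y + 2 ^+ r * (q * expR (- a)) * #|V|%:R).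
Proof.
move=> q01 a0 badP; have /andP[q0 q1] := q01.
pose good (A : {ffun V -> {set 'I_r}}) :=
  (#|marked A|%:R <= L) && (y <= #|Y A|%:R).
have kp0 W : 0 <= keep_prob q W :> R := @keep_prob_ge0 R V q W q01.
apply: (@le_trans _ _ (\sum_(A | good A)
    \sum_(W : {set V} | (marked A \subset W) && [disjoint W & Y A]) keep_prob q W)).
  rewrite (exchange_big_dep xpredT) //= big_mkcond /=; apply: ler_sum => W _.
  case: ifP => [/badP[A [AW WY AL yY]]|_]; last exact: sumr_ge0.
  rewrite (bigD1 A) /=; last by rewrite /good AL yY AW WY.
  by rewrite lerDl sumr_ge0.
apply: (@le_trans _ _ (\sum_(A | good A)
    expR (a * L - q * y) * (q * expR (- a)) ^+ #|marked A|)).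
  apply: ler_sum => A /andP[AL yY].
  apply: le_trans (keep_prob_between _ _ q01) _.
  rewrite exprMn mulrCA; apply: ler_wpM2l; first exact: exprn_ge0.
  rewrite -expRM_natl -expRD ler_expR.
  have h1 := ler_wpM2l a0 AL; have h2 := ler_wpM2l q0 yY; lra.
have x0 : 0 <= q * expR (- a) by rewrite mulr_ge0 // ltW // expR_gt0.
rewrite [leRHS]expRD; apply: le_trans (ler_wpM2l _ (sum_marked V r x0)); last first.
  by rewrite ltW // expR_gt0.
rewrite mulr_sumr big_mkcond; apply: ler_sum => A _; case: ifP => // _.
by rewrite mulr_ge0 ?exprn_ge0 // ltW // expR_gt0.
Qed.

(** In the exponent of the union bound, [a] makes the entropy term and then [C] the certificate term
    at most a quarter of [q * y * N]; half of the gain [q * y * N] is left. *)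
Lemma prob_ramsey_ge (R : realType) (r k : nat) (c eps : R) :
  (0 < r)%N -> 0 < c -> 0 < eps ->
  exists C delta p0 : R, [/\ 1 <= C, 0 < delta, 0 < p0 &
  forall (H : hypergraph k) (p q : R), 0 < p -> p <= p0 ->
    1 <= p * (nvert H)%:R -> (0 < nedge H)%N ->
    (forall l : nat, (1 <= l <= k)%N ->
      (maxdeg H l)%:R <= c * p ^+ l.-1 * ((nedge H)%:R / (nvert H)%:R)) ->
    supersaturated r eps H -> C * p <= q -> q <= 1 ->
    1 - expR (- (delta * (p * (nvert H)%:R)))
      <= prob_vrandom H q (@ramsey k r)].
Proof.
move=> r0 c0 e0; have [K [p0 [K0 p00 marks]]] := not_ramsey_marked k r0 c0 e0.
set y := eps / (2 * c) in marks; have y0 : 0 < y.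
  by rewrite divr_gt0 // mulr_gt0.
clearbody y.
have P0 : 0 < 2 ^+ r :> R by rewrite exprn_gt0.
(* Chosen so that [expR (- a) <= a^-1] yields [ea]. *)
pose a := (y / (4 * 2 ^+ r))^-1.
have a0 : 0 < a by rewrite invr_gt0 divr_gt0 // mulr_gt0.
have ea : 2 ^+ r * expR (- a) <= y / 4.
  have h : a <= expR a by apply: le_trans (expR_ge1Dx a); rewrite lerDr.
  have -> : y / 4 = 2 ^+ r * a^-1 by rewrite invrK; field; rewrite gt_eqF.
  by rewrite ler_pM2l // expRN lef_pV2 // posrE // expR_gt0.
have aK : 0 <= 4 * a * K / y.
  by apply: divr_ge0 (ltW y0); apply: mulr_ge0 K0; apply: mulr_ge0 (ltW a0).
exists (1 + 4 * a * K / y), (y / 2), p0; split=> //; rewrite ?lerDl ?divr_gt0 //.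
move=> H p q pp ple pN E0 deg sat Cpq q1.
have [Y YP] := marks H p pp ple pN E0 deg sat.
have pq : p <= q.
  by apply: le_trans Cpq; rewrite mulrDl mul1r lerDl mulr_ge0 // ltW.
have q01 : 0 <= q <= 1 by rewrite q1 (le_trans (ltW pp) pq).
have q0 : 0 <= q by case/andP: q01.
have aKp : a * K * p <= y / 4 * q.
  have h : 4 * a * K / y * p <= q.
    by apply: le_trans Cpq; rewrite ler_wpM2r ?(ltW pp) // lerDr.
  have := ler_wpM2l (ltW y0) h.
  have -> : y * (4 * a * K / y * p) = 4 * (a * K * p) by field; rewrite gt_eqF.
  lra.
rewrite lerBlDr addrC -lerBlDr -prob_not_ramsey.
apply: le_trans (union_bound_marked q01 (ltW a0) YP) _.
rewrite ler_expR /nvert; set N : R := #|vert H|%:R.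
have N0 : 0 <= N by rewrite ler0n.
have h1 := ler_wpM2r N0 aKp.
have h2 := ler_wpM2r N0 (ler_wpM2l q0 ea).
have h3 := ler_wpM2r N0 (ler_wpM2l (ltW y0) pq).
lra.
Qed.

(* Passage to the limit *)
From mathcomp Require Import all_classical all_reals all_analysis.
Import numFieldNormedType.Exports.

Local Open Scope classical_set_scope.

Theorem theorem8p1 (R : realType) (r k : nat) (c : R)
    (H : nat -> hypergraph k) (p : nat -> R)
    (hr : (2 <= r)%N) (hk : (2 <= k)%N) (hc : 0 < c)
    (hp : forall n : nat, 0 < p n < 1)
    (hp0 : p n @[n --> \oo] --> (0 : R))
    (hpv : p n * (nvert (H n))%:R @[n --> \oo] --> +oo)
    (hE : \forall n \near \oo, (0 < nedge (H n))%N)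
    (hdelta : \forall n \near \oo, forall l : nat, (1 <= l <= k)%N ->
      (maxdeg (H n) l)%:R
        <= c * p n ^+ l.-1 * ((nedge (H n))%:R / (nvert (H n))%:R))
    (hsat : @supersaturated_seq R k r H) :
  exists C : R, 1 <= C /\
    forall q : nat -> R,
      (\forall n \near \oo, C * p n <= q n <= 1) ->
      prob_vrandom (H n) (q n) (@ramsey k r) @[n --> \oo] --> (1 : R).
Proof.
have [eps [e0 [n0 sat]]] := hsat.
have r0 : (0 < r)%N by apply: leq_trans hr.
have [C [dl [p0 [C1 dl0 p00 bound]]]] := prob_ramsey_ge k r0 hc e0.
exists C; split=> // q hq.
have p_small : \forall n \near \oo, p n <= p0.
  exact: (cvgr_le (f := p) 0 hp0).
have pN1 : \forall n \near \oo, 1 <= p n * (nvert (H n))%:R.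
  exact: (cvgryPge _).1.
(* The lower bound tends to 1 because [p n * nvert (H n)] tends to infinity. *)
apply: (@squeeze_cvgr _ _ _ _ (fun n => 1 - expR (- (dl * (p n * (nvert (H n))%:R)))) (fun=> 1)).
- near=> n.
  have /andP[Cpq q1] : C * p n <= q n <= 1 by near: n.
  have /andP[pp _] := hp n.
  have q01 : 0 <= q n <= 1.
    rewrite q1 andbT; apply: le_trans Cpq; rewrite mulr_ge0 ?(ltW pp) //.
    exact: le_trans C1.
  apply/andP; split; last exact: prob_ramsey_le1.
  apply: bound => //; first by near: n.
  + by near: n.
  + by near: n.
  + by near: n.
  + by apply: sat; near: n; exists n0.
- rewrite -[X in _ --> X]subr0; apply: cvgB; first exact: cvg_cst.
  apply: (@cvg_comp _ _ _ (fun n => dl * (p n * (nvert (H n))%:R))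
    (fun x => expR (- x)) _ _ _ _ (@cvgr_expR R)).
  apply/cvgryPge => a; have /cvgryPge/(_ (a / dl)) := hpv.
  by apply: filterS => n; rewrite ler_pdivrMr // mulrC.
- exact: cvg_cst.
Unshelve. all: by end_near.
Qed.
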